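(* Let $A$ be the generic limit algebra of an hr-asymmetric system of 4-cycle algebras. Then the joint scale $\Sigma A$ in $K_0A\oplus H_1A$ is not invariant under the homology inversion $\gamma_0\oplus\gamma_1=\mathrm{id}\oplus(-1)$.
   Context: 4-cycle algebras. For positive integers $n_1,\dots,n_4$ with $r=\sum n_i$, the 4-cycle algebra with these block sizes is the algebra $A\subseteq M_r(\mathbb C)$ of block matrices $(a_{ij})$, $a_{ij}\in M_{n_i,n_j}(\mathbb C)$, with $a_{ij}=0$ unless $i=j$ or ($i\in\{1,2\}$, $j\in\{3,4\}$). $A(D_4)$ is the case $n_1=\dots=n_4=1$, with matrix units $e_{ij}$. $Q_1,\dots,Q_4$ denote the block projections. $C^*(A)=M_r(\mathbb C)$. An embedding (injective homomorphism) $\phi:A\to A'$ is star extendible if it extends to a $*$-homomorphism $C^*(A)\to C^*(A')$. A multiplicity one star extendible embedding is rigid of type $\theta$ if $\theta$ is a permutation of $\{1,2,3,4\}$ preserving $\{1,2\}$ and $\{3,4\}$ and $\phi(Q_iAQ_j)\subseteq Q'_{\theta(i)}A'Q'_{\theta(j)}$ for all $i,j$ (four types: $\mathrm{id},(12),(34),(12)(34)$). A rigid embedding is a sum of multiplicity one rigid embeddings with mutually orthogonal ranges; it is generic if all four types occur. $H_1$ of a 4-cycle algebra is $\mathbb Z$ (with $g$ the generator given by the cycle $1,3,2,4$), and for $\phi$ rigid $H_1(\phi)$ is multiplication by (number of summands of type $\mathrm{id}$ or $(12)(34)$) minus (number of type $(12)$ or $(34)$); we identify $H_1(\phi)$ with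 this integer. $K_0$ of a 4-cycle algebra $A$ is $K_0(A\cap A^* )=\mathbb Z^4$. A generic system is a direct system $(A_k,\alpha_k)$ of 4-cycle algebras with all $\alpha_k$ generic, and $A$ is its algebraic direct limit. $K_0A=\varinjlim K_0(A_k)$, $H_1A=\varinjlim(H_1(A_k),H_1(\alpha_k))$. The joint scale $\Sigma A\subseteq K_0A\oplus H_1A$ is the set of elements $(K_0\phi([e_{11}\oplus e_{33}]),(H_1\phi)(g))$ for rigid embeddings $\phi:A(D_4)\to A_k$, $k\ge1$. The homology range of a rigid embedding $\alpha:A_1\to A_2$ is the set of integers $H_1(\beta)$ over all rigid $\beta:A_1\to A_2$ with $K_0(\beta)=K_0(\alpha)$. The system is hr-asymmetric if for each pair $i\le j$ the homology range of $\alpha_j\circ\cdots\circ\alpha_i$ lies in $\mathbb Z_+$ or in $\mathbb Z_-$ and does not contain $0$. *)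

(* Defs.v *)
From HB Require Import structures.
From mathcomp Require Import all_boot all_order all_algebra all_fingroup complex.
From mathcomp Require Import zify.
From mathcomp Require Import boolp classical_sets reals.

Set Implicit Arguments.
Unset Strict Implicit.
Unset Printing Implicit Defensive.

Import Order.TTheory GRing.Theory Num.Theory.

Local Open Scope ring_scope.
Local Open Scope quotient_scope.
Local Open Scope sesquilinear_scope.
Local Open Scope complex_scope.
Local Open Scope classical_set_scope.

(* Direct limit of G -> G -> G -> ... along f 0, f 1, ...: a single group G is
   enough because K_0 (resp. H_1) of every 4-cycle algebra is Z^4 (resp. Z). *)
Section DirectLimit.
Variables (G : zmodType) (f : nat -> {additive G -> G}).

Fixpoint push (i m : nat) (x : G) : G :=
  if m is m'.+1 then f (m' + i)%N (push i m' x) else x.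

Lemma push_is_zmod_morphism i m : zmod_morphism (push i m).
Proof. by move=> x y; elim: m => //= m ->; rewrite raddfB. Qed.

HB.instance Definition _ i m :=
  GRing.isZmodMorphism.Build G G (push i m) (push_is_zmod_morphism i m).

Lemma push_add i m p x : push i (p + m) x = push (m + i) p (push i m x).
Proof. by elim: p => //= p ->; rewrite addnA. Qed.

(* From stage i to stage j; meaningful only when i <= j. *)
Definition trans (i j : nat) : {additive G -> G} := push i (j - i).

Lemma transE i j x : trans i j x = push i (j - i) x.
Proof. by []. Qed.

Lemma trans_id i x : trans i i x = x.
Proof. by rewrite transE subnn. Qed.

Lemma trans_comp i j k x : (i <= j <= k)%N -> trans j k (trans i j x) = trans i k x.
Proof.
case/andP=> leij lejk; rewrite !transE.
have -> : (k - i = (k - j) + (j - i))%N by rewrite addnBA // subnK.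
by rewrite push_add subnK.
Qed.

Definition dlim_equiv (x y : nat * G) : bool :=
  `[< exists2 k, (x.1 <= k)%N && (y.1 <= k)%N
               & trans x.1 k x.2 = trans y.1 k y.2 >].

Lemma dlim_equiv_is_equiv : equiv_class_of dlim_equiv.
Proof.
split=> [x | x y | y x z].
- by apply/asboolP; exists x.1; rewrite ?leqnn.
- by apply/asboolP/asboolP=> -[k le_k eq_k]; exists k; rewrite // andbC.
case/asboolP=> k /andP[xk yk] xy /asboolP[l /andP[yl zl] yz].
apply/asboolP; exists (maxn k l).
  by rewrite (leq_trans xk) ?leq_maxl // (leq_trans zl) ?leq_maxr.
rewrite -(@trans_comp x.1 k) ?xk ?leq_maxl // xy.
rewrite -[RHS](@trans_comp z.1 l) ?zl ?leq_maxr // -yz.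
by rewrite !trans_comp ?yk ?yl ?leq_maxl ?leq_maxr.
Qed.

Canonical dlim_equiv_equiv := EquivRelPack dlim_equiv_is_equiv.

Definition dlim : Type := {eq_quot dlim_equiv}.
HB.instance Definition _ := Choice.on dlim.
HB.instance Definition _ := Quotient.on dlim.
HB.instance Definition _ : EqQuotient _ dlim_equiv dlim := EqQuotient.on dlim.

Definition dlim_in (i : nat) (x : G) : dlim := \pi_dlim (i, x).

Lemma dlim_inP i j x y : dlim_in i x = dlim_in j y <->
  exists2 k, (i <= k)%N && (j <= k)%N & trans i k x = trans j k y.
Proof.
by split=> [/eqmodP/asboolP | xy]; [| apply/eqmodP/asboolP].
Qed.

Lemma dlim_in_trans i j x : (i <= j)%N -> dlim_in j (trans i j x) = dlim_in i x.
Proof.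
by move=> ij; apply/dlim_inP; exists j; rewrite ?ij ?leqnn // trans_id.
Qed.

Lemma dlimW (P : dlim -> Prop) : (forall i x, P (dlim_in i x)) -> forall X, P X.
Proof. by move=> PH; elim/quotW=> -[i x]; apply: PH. Qed.

Let add_rep (x y : nat * G) : nat * G :=
  let k := maxn x.1 y.1 in (k, trans x.1 k x.2 + trans y.1 k y.2).
Let opp_rep (x : nat * G) : nat * G := (x.1, - x.2).

Definition dlim_zero : dlim := dlim_in 0 0.
Definition dlim_opp (X : dlim) : dlim := \pi_dlim (opp_rep (generic_quotient.repr X)).
Definition dlim_add (X Y : dlim) : dlim :=
  \pi_dlim (add_rep (generic_quotient.repr X) (generic_quotient.repr Y)).

Lemma dlim_oppE i x : dlim_opp (dlim_in i x) = dlim_in i (- x).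
Proof.
rewrite /dlim_opp /opp_rep; have := reprK (dlim_in i x); case: (generic_quotient.repr _) => j y /=.
case/dlim_inP=> k jik eq_k; apply/dlim_inP; exists k => //.
by rewrite !raddfN eq_k.
Qed.

Lemma dlim_addE i x j y k : (i <= k)%N -> (j <= k)%N ->
  dlim_add (dlim_in i x) (dlim_in j y) = dlim_in k (trans i k x + trans j k y).
Proof.
move=> ik jk; rewrite /dlim_add /add_rep.
have := reprK (dlim_in i x); case: (generic_quotient.repr _) => i' x' /dlim_inP[a].
case/andP=> i'a ia eq_a.
have := reprK (dlim_in j y); case: (generic_quotient.repr _) => j' y' /dlim_inP[b].
case/andP=> j'b jb eq_b; rewrite -/(dlim_in _ _).
set m := maxn i' j'; set l := maxn (maxn a b) (maxn m k).
have al : (a <= l)%N by rewrite !leq_max leqnn.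
have bl : (b <= l)%N by rewrite !leq_max leqnn !orbT.
have ml : (m <= l)%N by rewrite /l leq_max [X in _ || X]leq_max leqnn orbT.
have kl : (k <= l)%N by rewrite /l leq_max [X in _ || X]leq_max leqnn !orbT.
have i'm : (i' <= m)%N by rewrite leq_maxl.
have j'm : (j' <= m)%N by rewrite leq_maxr.
apply/dlim_inP; exists l; first by rewrite ml kl.
rewrite !raddfD !trans_comp ?ml ?kl ?ik ?jk ?i'm ?j'm //.
rewrite -(@trans_comp i' a) ?i'a ?al // eq_a trans_comp ?ia ?al //.
by rewrite -(@trans_comp j' b) ?j'b ?bl // eq_b trans_comp ?jb ?bl.
Qed.

Lemma dlim_addC : commutative dlim_add.
Proof.
elim/dlimW=> i x; elim/dlimW=> j y.
by rewrite !(@dlim_addE _ _ _ _ (maxn i j)) ?leq_maxl ?leq_maxr // addrC.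
Qed.

Lemma dlim_addA : associative dlim_add.
Proof.
elim/dlimW=> i x; elim/dlimW=> j y; elim/dlimW=> k z.
set l := maxn i (maxn j k).
have il : (i <= l)%N by rewrite leq_max leqnn.
have jl : (j <= l)%N by rewrite /l leq_max [X in _ || X]leq_max leqnn orbT.
have kl : (k <= l)%N by rewrite /l leq_max [X in _ || X]leq_max leqnn !orbT.
by do !rewrite (@dlim_addE _ _ _ _ l) ?leqnn //; rewrite !trans_id addrA.
Qed.

Lemma dlim_add0 : left_id dlim_zero dlim_add.
Proof.
elim/dlimW=> i x; rewrite /dlim_zero (@dlim_addE _ _ _ _ i) //.
by rewrite raddf0 add0r trans_id.
Qed.

Lemma dlim_addN : left_inverse dlim_zero dlim_opp dlim_add.
Proof.
elim/dlimW=> i x; rewrite dlim_oppE (@dlim_addE _ _ _ _ i) // !trans_id addNr.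
by rewrite /dlim_zero -(@dlim_in_trans 0 i) // raddf0.
Qed.

HB.instance Definition _ :=
  GRing.isZmodule.Build dlim dlim_addA dlim_addC dlim_add0 dlim_addN.

End DirectLimit.

Section FourCycle.
Variable R : realType.
Local Notation C := R[i].
Implicit Types n : 'I_4 -> nat.

(* The indices 1, 2, 3, 4 become 0, 1, 2, 3 : 'I_4, so {1, 2} is given by i < 2. *)
Definition cycle4_entry (i j : 'I_4) : bool :=
  (i == j) || ((i < 2)%N && (2 <= j)%N).

Definition cycle4_pred n : {pred 'M[C]_(\sum_i n i)} :=
  [pred a | [forall i, forall j,
     ~~ cycle4_entry i j ==> (submxblock a i j == 0)]].

Arguments cycle4_pred : clear implicits.

Lemma cycle4_predP n (a : 'M[C]_(\sum_i n i)) :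
  reflect (forall i j, ~~ cycle4_entry i j -> submxblock a i j = 0)
          (a \in cycle4_pred n).
Proof.
apply: (iffP forallP) => [H i j nij | H i]; last first.
  by apply/forallP=> j; apply/implyP=> nij; apply/eqP; apply: H.
by have /forallP/(_ j)/implyP/(_ nij)/eqP := H i.
Qed.

Lemma submxblockM n (a b : 'M[C]_(\sum_i n i)) i j :
  submxblock (a *m b) i j = \sum_k submxblock a i k *m submxblock b k j.
Proof.
by rewrite -{1}[a]submxblockK -{1}[b]submxblockK mul_mxblock mxblockK.
Qed.

Lemma submxblock_mxdiagN n (B : forall i, 'M[C]_(n i)) i j : i != j ->
  submxblock (\mxdiag_i B i) i j = 0.
Proof. by move=> /negPf nij; rewrite mxblockK nij. Qed.

Lemma mxdiag_in n (B : forall i, 'M[C]_(n i)) : \mxdiag_i B i \in cycle4_pred n.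
Proof.
apply/cycle4_predP=> i j; rewrite negb_or => /andP[nij _].
exact: submxblock_mxdiagN.
Qed.

Lemma cycle4_trans i k j : cycle4_entry i k -> cycle4_entry k j -> cycle4_entry i j.
Proof.
rewrite /cycle4_entry => /orP[/eqP-> // | /andP[i2 k2]] /orP[/eqP<- | /andP[k2' _]].
  by rewrite i2 k2 orbT.
by rewrite ltnNge k2 in k2'.
Qed.

Lemma cycle4_subring n : subring_closed (cycle4_pred n).
Proof.
split=> [|a b /cycle4_predP Ha /cycle4_predP Hb|a b /cycle4_predP Ha /cycle4_predP Hb].
- by rewrite (_ : 1 = \mxdiag_i (1%:M : 'M[C]_(n i))) ?mxdiag_in // mxdiagZ.
- by apply/cycle4_predP=> i j nij; rewrite submxblockB Ha ?Hb ?subrr.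
apply/cycle4_predP=> i j nij; rewrite submxblockM big1 // => k _.
have [ik|/Ha-> //] := boolP (cycle4_entry i k); last by rewrite mul0mx.
have [kj|/Hb-> //] := boolP (cycle4_entry k j); last by rewrite mulmx0.
by rewrite (cycle4_trans ik kj) in nij.
Qed.

Lemma cycle4_scaler n : GRing.scaler_closed (cycle4_pred n).
Proof.
move=> c a /cycle4_predP Ha; apply/cycle4_predP=> i j nij.
have : submxblock (c *: a) i j = c *: submxblock a i j by apply/matrixP=> s t; rewrite !mxE.
by rewrite Ha // scaler0.
Qed.

HB.instance Definition _ n :=
  GRing.isSubringClosed.Build _ (cycle4_pred n) (@cycle4_subring n).
HB.instance Definition _ n :=
  GRing.isScaleClosed.Build _ _ (cycle4_pred n) (@cycle4_scaler n).

Record cycle4 n := Cycle4 {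
  cycle4_mx :> 'M[C]_(\sum_i n i);
  _ : cycle4_mx \in cycle4_pred n
}.

HB.instance Definition _ n := [isSub for @cycle4_mx n].
HB.instance Definition _ n := [Choice of cycle4 n by <:].
HB.instance Definition _ n :=
  GRing.SubChoice_isSubPzRing.Build _ _ (cycle4 n) (@cycle4_subring n).
HB.instance Definition _ n := [SubZmodule_isSubLmodule of cycle4 n by <:].

Definition diag_elt n (B : forall i, 'M[C]_(n i)) : cycle4 n :=
  Cycle4 (mxdiag_in B).

Definition Q n (i : 'I_4) : cycle4 n :=
  diag_elt (fun k => if k == i then 1%:M else 0 : 'M[C]_(n k)).

(* A rank one projection in the i-th diagonal block (when 0 < n i). *)
Definition min_proj n (i : 'I_4) : cycle4 n :=
  diag_elt (fun k => if k == i then pid_mx 1 else 0 : 'M[C]_(n k)).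

Definition corner n (i j : 'I_4) : set (cycle4 n) :=
  [set Q n i * a * Q n j | a in setT].
Arguments corner : clear implicits.

(* Embeddings need not be unital. *)
Record embedding n n' := Embedding {
  emb_fun :> {linear cycle4 n -> cycle4 n'};
  embM : {morph emb_fun : a b / a * b};
  emb_inj : injective emb_fun
}.

Section Comp.
Variables (n n' n'' : 'I_4 -> nat) (psi : embedding n' n'') (phi : embedding n n').
Let comp_fun : {linear cycle4 n -> cycle4 n''} := psi \o phi.
Lemma comp_embM : {morph comp_fun : a b / a * b}.
Proof. by move=> a b /=; rewrite !embM. Qed.
Lemma comp_emb_inj : injective comp_fun.
Proof. by move=> a b /= /emb_inj/emb_inj. Qed.
Definition comp_emb : embedding n n'' := Embedding comp_embM comp_emb_inj.
End Comp.

(* Phi is a *-homomorphism C*(A) -> C*(A') extending phi : A -> A', where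
   C*(A) is the full matrix algebra. *)
Definition star_extension n n' (phi : embedding n n')
    (Phi : {linear 'M[C]_(\sum_i n i) -> 'M[C]_(\sum_i n' i)}) : Prop :=
  [/\ {morph Phi : a b / a *m b}, {morph Phi : a / a ^t*}
    & forall a : cycle4 n, Phi a = phi a].

Definition projection r (p : 'M[C]_r) : Prop := p *m p = p /\ p ^t* = p.

(* The multiplicity of a *-homomorphism between full matrix algebras is the
   rank of the image of a rank one projection. *)
Definition multiplicity_one n n' (phi : embedding n n') : Prop :=
  exists2 Phi, star_extension phi Phi
    & forall p, projection p -> \rank p = 1%N -> \rank (Phi p) = 1%N.

Definition rigid_of_type n n' (theta : 'S_4) (phi : embedding n n') : Prop :=
  [/\ multiplicity_one phi,
      forall i : 'I_4, (theta i < 2)%N = (i < 2)%N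
    & forall i j, phi @` corner n i j `<=` corner n' (theta i) (theta j)].

(* phi is the sum of multiplicity one rigid embeddings with mutually orthogonal
   ranges, whose types are listed by ts. As psi s 1 and psi t 1 are projections,
   orthogonality of the ranges amounts to the vanishing of all products. *)
Definition rigid_sum n n' (phi : embedding n n') (ts : seq 'S_4) : Prop :=
  exists psi : 'I_(size ts) -> embedding n n',
  [/\ forall s, rigid_of_type (tnth (in_tuple ts) s) (psi s),
      forall s t, s != t -> forall a b, psi s a * psi t b = 0
    & forall a, phi a = \sum_s psi s a].

Definition rigid n n' (phi : embedding n n') : Prop :=
  exists ts, rigid_sum phi ts.

Definition tau12 : 'S_4 := tperm (inord 0) (inord 1).
Definition tau34 : 'S_4 := tperm (inord 2) (inord 3).

Definition generic n n' (phi : embedding n n') : Prop :=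
  exists2 ts, rigid_sum phi ts
    & {subset [:: 1%g; tau12; tau34; (tau12 * tau34)%g] <= ts}.

(* The class in K_0(A) = K_0(A \cap A^* ) = Z^4 of a projection of A. *)
Definition K0_class n (p : cycle4 n) : 'rV[int]_4 :=
  \row_i (\rank (submxblock p i i))%:Z.

(* Row i is the class of the image of a generator of the i-th summand of Z^4; see
   K0_classE for the compatibility of K0 phi with classes of projections. *)
Definition K0_mx n n' (phi : embedding n n') : 'M[int]_4 :=
  \matrix_i K0_class (phi (min_proj n i)).

Definition K0 n n' (phi : embedding n n') : {additive 'rV[int]_4 -> 'rV[int]_4} :=
  mulmxr (K0_mx phi).

Definition H1_degree (ts : seq 'S_4) : int :=
  (count_mem 1%g ts + count_mem (tau12 * tau34)%g ts)%:Z
  - (count_mem tau12 ts + count_mem tau34 ts)%:Z.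

(* When phi is rigid this does not depend on the decomposition chosen: see H1E. *)
Definition H1 n n' (phi : embedding n n') : int :=
  H1_degree (xget [::] [set ts | rigid_sum phi ts]).

Definition H1_map (d : int) (x : int) : int := d * x.
Lemma H1_map_is_zmod_morphism d : zmod_morphism (H1_map d).
Proof. exact: mulrBr. Qed.
HB.instance Definition _ d :=
  GRing.isZmodMorphism.Build int int (H1_map d) (H1_map_is_zmod_morphism d).

Definition homology_range n n' (alpha : embedding n n') : set int :=
  [set H1 beta | beta in [set beta : embedding n n' |
                            rigid beta /\ K0 beta =1 K0 alpha]].

Lemma mxtrace_idem (F : fieldType) r (p : 'M[F]_r) :
  p *m p = p -> \tr p = (\rank p)%:R.
Proof.
move=> pp; have cd := mulmx_base p; move: cd (row_base_free p) (col_base_full p).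
move: (row_base p) (col_base p) => d c cd /row_free_inj fd /row_full_inj fc.
suff dc : d *m c = 1%:M by rewrite -[in LHS]cd mxtrace_mulC dc mxtrace1.
by apply/fd/fc; rewrite /= mul1mx mulmxA mulmxA cd -mulmxA cd pp.
Qed.

Lemma submxblock_adj n (a : 'M[C]_(\sum_i n i)) i j :
  submxblock (a ^t*) i j = (submxblock a j i)^t*.
Proof. by apply/matrixP=> s t; rewrite !mxE. Qed.

Lemma cycle4_mx_sum n (I : finType) (F : I -> cycle4 n) :
  cycle4_mx (\sum_i F i) = \sum_i cycle4_mx (F i).
Proof. by apply: (big_morph _ (op1 := +%R) (id1 := 0)). Qed.

Lemma trace_functional m (T : {linear 'M[C]_m -> C^o}) (s : 'I_m) :
    (forall A B, T (A *m B) = T (B *m A)) ->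
  forall A, T A = \tr A * T (delta_mx s s).
Proof.
move=> TC A; rewrite [A in LHS]matrix_sum_delta raddf_sum mulr_suml /=.
apply: eq_bigr => i _; rewrite raddf_sum (bigD1 i) //= big1 => [|j ji].
  rewrite addr0 linearZ /=; congr (_ * _).
  by rewrite -(mul_delta_mx s) TC mul_delta_mx.
by rewrite linearZ /= -(mul_delta_mx i) TC mul_delta_mx_0 ?raddf0 ?mulr0.
Qed.

Lemma submxblockM_diag n (a b : cycle4 n) j :
  submxblock (a * b : cycle4 n) j j = submxblock a j j *m submxblock b j j.
Proof.
rewrite [LHS]submxblockM (bigD1 j) //= big1 ?addr0 // => k kj.
have [jk|/(cycle4_predP _ (valP a))-> //] := boolP (cycle4_entry j k);
  last by rewrite mul0mx.
have [kj'|/(cycle4_predP _ (valP b))-> //] := boolP (cycle4_entry k j);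
  last by rewrite mulmx0.
move: jk kj'; rewrite /cycle4_entry (negPf kj) eq_sym (negPf kj) /=.
by case/andP=> j2 k2 /andP[k2' _]; rewrite ltnNge k2 in k2'.
Qed.

Definition diag_block n i (B : 'M[C]_(n i)) : cycle4 n :=
  diag_elt (fun k => if k == i then conform_mx 0 B else 0).

Lemma diag_blockE n i (B : 'M[C]_(n i)) a b :
  submxblock (diag_block B) a b =
    if (a == i) && (b == i) then conform_mx 0 B else 0.
Proof.
have [<-|ab] := eqVneq a b; first by rewrite andbb submxblock_diag.
rewrite submxblock_mxdiagN //; case: andP => // -[/eqP ai /eqP bi].
by rewrite ai bi eqxx in ab.
Qed.

Lemma diag_block_linear n i : linear (@diag_block n i).
Proof.
move=> c A B; apply: val_inj; apply/mxblockP=> a b.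
transitivity (c *: submxblock (diag_block A) a b + submxblock (diag_block B) a b).
  rewrite !diag_blockE; case: andP => [[/eqP-> /eqP->]|_].
    by rewrite !conform_mx_id.
  by rewrite scaler0 addr0.
by apply/matrixP=> s t; rewrite !mxE.
Qed.

Lemma diag_blockM n i (A B : 'M[C]_(n i)) :
  diag_block (A *m B) = diag_block A * diag_block B.
Proof.
apply: val_inj; apply/mxblockP=> a b.
transitivity (\sum_k submxblock (diag_block A) a k *m submxblock (diag_block B) k b);
  last by rewrite -submxblockM.
rewrite [RHS](bigD1 i) //= [X in _ + X]big1 => [|k /negPf ki]; last first.
  by rewrite !diag_blockE ki andbF mul0mx.
rewrite addr0 !diag_blockE !eqxx andbT /=.
have [->|_] := eqVneq a i; last by rewrite mul0mx.
by have [->|_] := eqVneq b i; rewrite /= ?mulmx0 // !conform_mx_id.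
Qed.

Lemma min_projE n i : min_proj n i = diag_block (pid_mx 1 : 'M[C]_(n i)).
Proof.
apply: val_inj; apply/eq_mxdiagP=> k.
by case: eqVneq => // ->; rewrite conform_mx_id.
Qed.

Lemma K0_classE n n' (phi : embedding n n') (p : cycle4 n) :
  (forall i, 0 < n i)%N -> projection p -> K0_class (phi p) = K0 phi (K0_class p).
Proof.
move=> n_gt0 [pp padj].
have {}pp : p * p = p by exact: val_inj.
have pD i j : i != j -> submxblock p i j = 0.
  move=> ij; have [e|/(cycle4_predP _ (valP p))-> //] := boolP (cycle4_entry i j).
  rewrite -padj submxblock_adj (cycle4_predP _ (valP p)) ?trmx0 ?map_mx0 //.
  apply/negP; move: e; rewrite /cycle4_entry (negPf ij) eq_sym (negPf ij) /=.
  by case/andP=> _ j2 /andP[j2' _]; rewrite ltnNge j2 in j2'.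
have pE : p = \sum_i diag_block (submxblock p i i).
  apply: val_inj; apply/mxblockP=> a b.
  transitivity (submxblock (\sum_i cycle4_mx (diag_block (submxblock p i i))) a b);
    last by rewrite -cycle4_mx_sum.
  rewrite submxblock_sum [RHS](bigD1 a) //= [X in _ + X]big1 => [|k /negPf ka]; last first.
    by rewrite diag_blockE eq_sym ka.
  rewrite addr0 diag_blockE eqxx; case: eqVneq => [->|ba]; first by rewrite conform_mx_id.
  by rewrite pD // eq_sym.
apply/rowP=> j; rewrite !mxE.
pose t (a : cycle4 n) : C^o := \tr (submxblock (phi a) j j).
have tE a : a * a = a -> t a = (\rank (submxblock (phi a) j j))%:R.
  by move=> aa; rewrite /t mxtrace_idem // -submxblockM_diag -embM aa.
have tL i : linear (fun B : 'M[C]_(n i) => t (diag_block B)).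
  move=> c A B; rewrite /t diag_block_linear linearP.
  by rewrite /mxtrace /= scaler_sumr -big_split; apply: eq_bigr => s _; rewrite !mxE.
have key i : t (diag_block (submxblock p i i)) = (\rank (submxblock p i i))%:R * t (min_proj n i).
  pose Tm := GRing.isLinear.Build _ _ _ _ _ (tL i).
  pose T : {linear 'M[C]_(n i) -> C^o} := HB.pack (fun B : 'M[C]_(n i) => t (diag_block B)) Tm.
  have TC A B : T (A *m B) = T (B *m A).
    by rewrite /= /t !diag_blockM !embM !submxblockM_diag mxtrace_mulC.
  have := trace_functional (Ordinal (n_gt0 i)) TC (submxblock p i i).
  rewrite /= mxtrace_idem -?submxblockM_diag ?pp // => ->.
  congr (_ * _); congr (t _); rewrite min_projE; congr (diag_block _).
  apply/matrixP=> s u; rewrite !mxE -!val_eqE /=.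
  by case: (nat_of_ord s) (nat_of_ord u) => [|a] [|b]; rewrite ?andbF.
have tp : t p = \sum_i t (diag_block (submxblock p i i)).
  rewrite [in LHS]pE /t raddf_sum.
  by rewrite cycle4_mx_sum submxblock_sum raddf_sum.
apply/eqP; rewrite -(eqr_int C); apply/eqP.
rewrite -[LHS]/((\rank (submxblock (phi p) j j))%:R : C) -tE // tp raddf_sum /=.
apply: eq_bigr => i _; rewrite key !mxE intrM; congr (_ * _).
rewrite tE // min_projE -diag_blockM pid_mx_id //.
Qed.

(* A rank one partial isometry in the (i, j) block. *)
Definition rank1_mx n (i j : 'I_4) : 'M[C]_(\sum_i n i) :=
  \mxblock_(a, b) if (a == i) && (b == j) then pid_mx 1 else 0.

Lemma rank1_in n i j : cycle4_entry i j -> rank1_mx n i j \in cycle4_pred n.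
Proof.
move=> ij; apply/cycle4_predP=> a b; rewrite mxblockK.
by case: andP => // -[/eqP-> /eqP->]; rewrite ij.
Qed.

Lemma rank1_adj n i j : (rank1_mx n i j)^t* = rank1_mx n j i.
Proof.
apply/mxblockP=> a b; rewrite submxblock_adj !mxblockK andbC.
by case: ifP => _; rewrite ?trmx0 ?map_mx0 // tr_pid_mx map_pid_mx.
Qed.

Lemma rank1_mul n i j k : (0 < n j)%N ->
  rank1_mx n i j *m rank1_mx n j k = rank1_mx n i k.
Proof.
move=> nj; apply/mxblockP=> a b; rewrite submxblockM (bigD1 j) //=.
rewrite big1 => [|l /negPf nl]; last by rewrite !mxblockK nl andbF mul0mx.
rewrite addr0 !mxblockK eqxx andbT; case: eqP => _; last by rewrite mul0mx.
by case: eqP => _; rewrite ?mulmx0 // pid_mx_id.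
Qed.

Lemma rank1_projection n i : (0 < n i)%N ->
  projection (rank1_mx n i i) /\ \rank (rank1_mx n i i) = 1%N.
Proof.
move=> ni; have idem := rank1_mul i i ni.
split; first by split; rewrite ?rank1_adj.
have /eqP := mxtrace_idem idem.
have -> : rank1_mx n i i = \mxdiag_k (if k == i then pid_mx 1 else 0).
  apply/mxblockP=> a b; rewrite !mxblockK; have [->|nab] := eqVneq a b.
    by rewrite conform_mx_id andbb.
  by case: andP => // -[/eqP ai /eqP bi]; rewrite ai bi eqxx in nab.
rewrite mxtrace_mxdiag (bigD1 i) //= eqxx big1 ?addr0 => [|k /negPf->]; last exact: mxtrace0.
rewrite mxtrace_idem ?pid_mx_id // rank_pid_mx // eqr_nat.
by move/eqP.
Qed.

Lemma mulQQ n i j : Q n i * Q n j = if i == j then Q n i else 0.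
Proof.
apply: val_inj; apply/mxblockP=> a b.
transitivity (submxblock ((Q n i : 'M_(\sum_k n k)) *m (Q n j : 'M_(\sum_k n k))) a b) => //.
rewrite submxblockM (bigD1 a) //= big1 => [|k /negPf ka]; last first.
  by rewrite submxblock_mxdiagN ?mul0mx // eq_sym ka.
rewrite addr0 submxblock_diag (fun_if val) /=.
have [<-|nab] := eqVneq a b.
  rewrite submxblock_diag; have [->|nai] := eqVneq a i.
    by case: eqP => _; rewrite ?submxblock_diag ?eqxx ?mul1mx ?submxblock0.
  rewrite mul0mx; case: eqP => _; rewrite ?submxblock0 //.
  by rewrite submxblock_diag (negPf nai).
rewrite (@submxblock_mxdiagN n _ a b) // mulmx0.
by case: eqP; rewrite ?submxblock0 ?submxblock_mxdiagN.
Qed.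

Lemma rank1_corner n i j (ij : cycle4_entry i j) :
  Q n i * Cycle4 (rank1_in n ij) * Q n j = Cycle4 (rank1_in n ij).
Proof.
apply: val_inj; apply/mxblockP=> a b.
transitivity (submxblock ((Q n i : 'M_(\sum_k n k)) *m rank1_mx n i j
   *m (Q n j : 'M_(\sum_k n k))) a b) => //.
rewrite mul_mxdiag_mxblock mul_mxblock_mxdiag !mxblockK.
by have [->|] := eqVneq a i; have [->|] := eqVneq b j;
   rewrite /= ?mul1mx ?mulmx1 ?mulmx0 ?mul0mx.
Qed.

Lemma pres_inj (s t : 'S_4) :
    (forall i : 'I_4, (s i < 2)%N = (i < 2)%N) ->
    (forall i : 'I_4, (t i < 2)%N = (i < 2)%N) ->
  (s == t) = (s (inord 0) == t (inord 0)) && (s (inord 2) == t (inord 2)).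
Proof.
move=> ps pt; apply/eqP/andP => [-> // | [/eqP e0 /eqP e2]].
apply/permP=> i; apply: val_inj.
have v k : (k < 4)%N -> @inord 3 k = k :> nat by move=> ?; rewrite inordK.
have ne (u : {perm (ordinal 4)}) (k j : ordinal 4) : k != j -> val (u k) != val (u j).
  by move=> kj; apply/eqP=> /val_inj/perm_inj/eqP; apply/negP.
have [->|i0] := eqVneq i (inord 0); first by rewrite e0.
have [->|i2] := eqVneq i (inord 2); first by rewrite e2.
have := (ne s _ _ i0, ne t _ _ i0, ne s _ _ i2, ne t _ _ i2).
have := (ps i, pt i, ps (inord 0), ps (inord 2)).
have := (ltn_ord (s i), ltn_ord (t i)).
have := (ltn_ord (t (inord 0)), ltn_ord (t (inord 2))).
rewrite e0 e2 !v //= => -[c4 d4] [a4 b4] [[[a2 b2] c2] d2] [[[ac bc] ad] bd].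
by lia.
Qed.

Lemma adjM r (a b : 'M[C]_r) : (a *m b)^t* = b^t* *m a^t*.
Proof. by rewrite trmx_mul map_mxM. Qed.

Lemma star_tr n n' (phi : embedding n n') : multiplicity_one phi ->
  ((phi 1 : 'M_(\sum_i n' i))^t* = phi 1) /\
  forall i j (ij : cycle4_entry i j), (0 < n i)%N -> (0 < n j)%N ->
   let x := phi (Cycle4 (rank1_in n ij)) : 'M_(\sum_i n' i) in \tr (x *m x^t*) = 1.
Proof.
case=> Phi [PhiM PhiA PhiE] PhiR; split.
  have /= <- := PhiE 1; rewrite -PhiA; congr (Phi _).
  by rewrite -[LHS]/((1%:M : 'M[C]_(\sum_i n i))^t*) trmx1 map_mx1.
move=> i j ij ni nj /=; rewrite -!PhiE -PhiA -PhiM /= rank1_adj rank1_mul //.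
have [proj rk] := rank1_projection ni.
rewrite mxtrace_idem ?PhiR // -PhiM; congr (Phi _); exact: proj.1.
Qed.

Lemma rigid_sum_count n n' (phi : embedding n n') ts (theta : 'S_4)
    (ij : cycle4_entry (inord 0) (inord 2)) :
    (forall i, 0 < n i)%N -> rigid_sum phi ts ->
    (forall i : 'I_4, (theta i < 2)%N = (i < 2)%N) ->
  let y : cycle4 n' := Q n' (theta (inord 0)) * phi (Cycle4 (rank1_in n ij))
             * Q n' (theta (inord 2)) in
  (count_mem theta ts)%:R = \tr (cycle4_mx y *m y^t*).
Proof.
move=> n_gt0 [psi [psiR psiO phiE]] ptheta y; rewrite {}/y.
set E := Cycle4 _; set q0 := Q n' (theta (inord 0)); set q2 := Q n' (theta (inord 2)).
have yE : q0 * phi E * q2 = \sum_s (if tnth (in_tuple ts) s == theta then psi s E else 0).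
  rewrite phiE mulr_sumr mulr_suml; apply: eq_bigr => s _.
  have [_ psigma /(_ (inord 0) (inord 2)) corn] := psiR s.
  have [|b _ <-] := corn (psi s E); first by exists E => //; exists E; rewrite ?rank1_corner.
  rewrite [_ == theta]eq_sym (pres_inj ptheta psigma) !mulrA mulQQ -mulrA mulQQ.
  have [<-|] := eqVneq; last by rewrite !mul0r.
  rewrite [in X in _ * X]eq_sym.
  by have [<-|] := eqVneq; rewrite ?mulr0.
pose d s : 'M[C]_(\sum_i n' i) := if tnth (in_tuple ts) s == theta then psi s E else 0.
have -> : cycle4_mx (q0 * phi E * q2) = \sum_s d s.
  by rewrite yE (big_morph (@cycle4_mx n') (op1 := +%R) (id1 := 0)) //.
have dO s t : s != t -> d s *m (d t)^t* = 0.
  move=> st; rewrite /d; case: ifP => _; last by rewrite mul0mx.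
  case: ifP => _; last by rewrite trmx0 map_mx0 mulmx0.
  have [[mt _ _] [ms _ _]] := (psiR t, psiR s).
  rewrite -[in X in X *m _](mulr1 E) -[in X in _ *m X](mulr1 E) !embM /=.
  rewrite [X in _ *m X]adjM (star_tr mt).1 mulmxA.
  rewrite -[X in X *m _]mulmxA.
  have /(congr1 val) /= e := psiO s t st 1 1.
  by rewrite [X in _ *m X *m _]e mulmx0 mul0mx.
have -> : (\sum_s d s) *m (\sum_s d s)^t* = \sum_s d s *m (d s)^t*.
  rewrite mulmx_suml; apply: eq_bigr => s _.
  rewrite (raddf_sum trmx) (raddf_sum (map_mx Num.conj)) mulmx_sumr (bigD1 s) //=.
  by rewrite -[RHS]addr0; congr (_ + _); apply: big1 => t; rewrite eq_sym => /dO.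
rewrite raddf_sum /= -sum1_count natr_sum.
rewrite big_tnth /= big_mkcond /=; apply: eq_bigr => s _.
rewrite /d; have [|] := eqVneq; last by rewrite mul0mx mxtrace0.
by move=> _; rewrite (star_tr _).2 //; case: (psiR s).
Qed.
Lemma H1_degreeE n n' (phi : embedding n n') ts ts' : (forall i, 0 < n i)%N ->
  rigid_sum phi ts -> rigid_sum phi ts' -> H1_degree ts = H1_degree ts'.
Proof.
move=> n_gt0 Hts Hts'.
have ij : cycle4_entry (inord 0) (inord 2) by rewrite /cycle4_entry !inordK // orbT.
have E (theta : {perm (ordinal 4)}) : (forall i : 'I_4, (theta i < 2)%N = (i < 2)%N) ->
    count_mem theta ts = count_mem theta ts'.
  move=> pt; apply/eqP; rewrite -(eqr_nat C).
  by rewrite (rigid_sum_count ij n_gt0 Hts pt) (rigid_sum_count ij n_gt0 Hts' pt).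
have v k : (k < 4)%N -> @inord 3 k = k :> nat by move=> ?; rewrite inordK.
have p12 i : (tau12 i < 2)%N = (i < 2)%N.
  by rewrite /tau12; case: tpermP => [->|->|]; rewrite ?v.
have p34 i : (tau34 i < 2)%N = (i < 2)%N.
  by rewrite /tau34; case: tpermP => [->|->|]; rewrite ?v.
rewrite /H1_degree !E // => i; last by rewrite permM p34 p12.
by rewrite perm1.
Qed.

Lemma H1E n n' (phi : embedding n n') ts : (forall i, 0 < n i)%N ->
  rigid_sum phi ts -> H1 phi = H1_degree ts.
Proof.
move=> n_gt0 Hts; apply: (H1_degreeE n_gt0 _ Hts).
exact: (@xgetPex _ [::] [set ts | rigid_sum phi ts] (ex_intro _ ts Hts)).
Qed.

Record generic_system := GenericSystem {
  bsize : nat -> 'I_4 -> nat;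
  bsize_gt0 : forall k i, (0 < bsize k i)%N;
  alpha : forall k, embedding (bsize k) (bsize k.+1);
  alpha_generic : forall k, generic (alpha k)
}.

Section System.
Variable S : generic_system.

(* alpha_(m + i) o .. o alpha_i *)
Fixpoint alpha_comp (i m : nat) : embedding (bsize S i) (bsize S (m + i).+1) :=
  if m is m'.+1 then comp_emb (alpha S (m' + i).+1) (alpha_comp i m')
  else alpha S i.

Definition hr_asymmetric : Prop := forall i m,
  (homology_range (alpha_comp i m) `<=` [set d | 0 <= d] \/
   homology_range (alpha_comp i m) `<=` [set d | d <= 0]) /\
  ~ homology_range (alpha_comp i m) 0.

Definition K0_maps (k : nat) : {additive 'rV[int]_4 -> 'rV[int]_4} :=
  K0 (alpha S k).
Definition H1_maps (k : nat) : {additive int -> int} := H1_map (H1 (alpha S k)).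

Definition K0_lim : zmodType := dlim K0_maps.
Definition H1_lim : zmodType := dlim H1_maps.

(* The block sizes of A(D_4); there Q 0 and Q 2 are the matrix units e_11 and
   e_33, and the generator g of H_1(A(D_4)) = Z is 1. *)
Definition D4 (i : 'I_4) : nat := 1.

Definition joint_scale : set (K0_lim * H1_lim) :=
  [set x | exists k (phi : embedding D4 (bsize S k)), rigid phi /\
    x = (dlim_in K0_maps k (K0 phi (K0_class (Q D4 (inord 0) + Q D4 (inord 2)))),
         dlim_in H1_maps k (H1_map (H1 phi) 1))].

Definition homology_inversion (x : K0_lim * H1_lim) : K0_lim * H1_lim :=
  (x.1, - x.2).

End System.

End FourCycle.
Arguments joint_scale {R} S _.
Arguments homology_inversion {R} S x.

(* Main.v *)
Require Import Defs.
From HB Require Import structures.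
From mathcomp Require Import all_boot all_order all_algebra all_fingroup complex.
From mathcomp Require Import zify ring.
From mathcomp Require Import boolp classical_sets reals.

(* Decompose a rigid embedding as a |-> \sum_s V_s a V_s^* with isometries V_s that
   permute the blocks by theta_s; then K_0 is the sum of the permutation matrices
   of the theta_s, and H_1 is the sum of their signs. If the joint scale were
   invariant under the inversion, the class of a multiplicity one embedding of
   A(D_4) of type id into the first algebra would, with its homology component
   negated, come from some rigid psi : A(D_4) -> A_l, where l may be taken large.
   Let alpha : A_0 -> A_l be the composite of the system. Equality in K_0 says that
   the multisets of values theta_s(1), and of values theta_s(3), are the same for
   alpha and psi. So the restrictions of the isometries of alpha to the blocks
   {1, 2} and to the blocks {3, 4} can be paired differently, so as to realise the
   types of psi by an embedding beta : A_0 -> A_l with K_0 beta = K_0 alpha and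
   H_1 beta = - H_1 alpha, which contradicts hr-asymmetry. *)

Set Implicit Arguments.
Unset Strict Implicit.
Unset Printing Implicit Defensive.

Import Order.TTheory GRing.Theory Num.Theory.

Local Open Scope ring_scope.
Local Open Scope sesquilinear_scope.
Local Open Scope complex_scope.
Local Open Scope classical_set_scope.

(** * Matching two finite families with equal fibre sizes *)

(** Each [x] goes to the element of the fibre of [f] over [g x] whose position there is that of [x]
    in its own fibre of [g]. Equal images force equal fibres and positions, so the map is injective,
    and the cardinalities agree. *)
Lemma fiber_card_bij (I J T : finType) (f : I -> T) (g : J -> T) :
    (forall t, #|[pred y | f y == t]| = #|[pred x | g x == t]|) ->
  exists2 h : J -> I, bijective h & forall x, f (h x) = g x.
Proof.
move=> fg; have cardIJ : #|I| = #|J|.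
  rewrite -!sum1_card (partition_big f predT) //= [RHS](partition_big g predT) //=.
  by apply: eq_bigr => t _; rewrite !sum1_card; apply: fg.
have [x0 _|J0] := pickP {: J}; last first.
  have I0 : #|I| = 0%N by rewrite cardIJ; apply: eq_card0.
  have absurd (T' : Type) (x : J) : T' by have := J0 x.
  exists (fun x => absurd I x); last by move=> x; have := J0 x.
  by apply: inj_card_bij; [move=> x; have := J0 x | rewrite I0].
have [y0 _|I0] := pickP (fun y => f y == g x0); last first.
  by have := fg (g x0); rewrite (eq_card0 I0) (cardD1 x0) inE eqxx.
pose F x := enum [pred y | f y == g x]; pose G x := enum [pred x' | g x' == g x].
have sz x : (index x (G x) < size (F x))%N.
  by rewrite -cardE fg cardE index_mem mem_enum inE.
have fh x : f (nth y0 (F x) (index x (G x))) = g x.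
  by apply/eqP; have := mem_nth y0 (sz x); rewrite mem_enum inE.
exists (fun x => nth y0 (F x) (index x (G x))) => //.
apply: inj_card_bij; last by rewrite cardIJ.
move=> x x' e; have gx : g x = g x' by rewrite -fh e fh.
have FF : F x = F x' by rewrite /F gx.
have GG : G x = G x' by rewrite /G gx.
move/eqP: e; rewrite FF nth_uniq ?enum_uniq //; last by rewrite -FF.
by rewrite GG => /eqP; apply: (index_inj x0); rewrite mem_enum inE ?gx.
Qed.

(** * Adjoints, block projections and conjugation by an isometry *)

Section Conjugation.
Variable R : realType.
Local Notation C := R[i].
Implicit Types n : 'I_4 -> nat.

Definition respects_sides (theta : 'S_4) : Prop :=
  forall i : 'I_4, (theta i < 2)%N = (i < 2)%N.

Definition Qmx n (i : 'I_4) : 'M[C]_(\sum_k n k) := Q R n i.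

Lemma adjmxM m p q (a : 'M[C]_(m, p)) (b : 'M[C]_(p, q)) :
  (a *m b)^t* = b^t* *m a^t*.
Proof. by rewrite trmx_mul map_mxM. Qed.

Lemma adjmxK m p (a : 'M[C]_(m, p)) : (a^t*)^t* = a.
Proof. by apply/matrixP=> i j; rewrite !mxE conjCK. Qed.

Lemma adjmx1 m : (1%:M : 'M[C]_m)^t* = 1%:M.
Proof. by rewrite trmx1 map_mx1. Qed.

Lemma Qmx_adj n i : (Qmx n i)^t* = Qmx n i.
Proof.
apply/mxblockP=> a b; rewrite submxblock_adj.
have [<-|ab] := eqVneq a b; last first.
  by rewrite !submxblock_mxdiagN ?trmx0 ?map_mx0 // eq_sym.
rewrite submxblock_diag; case: eqP => _; last by rewrite trmx0 map_mx0.
exact: adjmx1.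
Qed.

Lemma QmxM n i j : Qmx n i *m Qmx n j = if i == j then Qmx n i else 0.
Proof. by have /(congr1 val) /= := mulQQ R n i j; rewrite (fun_if val). Qed.

Lemma sum_Qmx n : \sum_i Qmx n i = 1%:M.
Proof.
rewrite (_ : 1%:M = \mxdiag_i (1%:M : 'M[C]_(n i))); last by rewrite mxdiagZ.
apply/mxblockP=> a b; rewrite submxblock_sum.
have [<-|ab] := eqVneq a b; last first.
  by rewrite submxblock_mxdiagN // big1 // => k _; rewrite submxblock_mxdiagN.
rewrite submxblock_diag (bigD1 a) //= big1 => [|k /negPf ka].
  by rewrite submxblock_diag eqxx addr0.
by rewrite submxblock_diag eq_sym ka.
Qed.

(** Recasts a block condition as an identity between products, which conjugation can transport. *)
Lemma Qmx_block0 n (a : 'M[C]_(\sum_k n k)) i j :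
  submxblock a i j = 0 <-> Qmx n i *m a *m Qmx n j = 0.
Proof.
have QaQ k l : submxblock (Qmx n i *m a *m Qmx n j) k l =
    (if k == i then 1%:M else 0) *m submxblock a k l *m (if l == j then 1%:M else 0).
  by rewrite -{1}[a]submxblockK mul_mxdiag_mxblock mul_mxblock_mxdiag mxblockK.
split=> [a0|/(congr1 (fun b => submxblock b i j))]; last first.
  by rewrite QaQ !eqxx mul1mx mulmx1 submxblock0.
apply/mxblockP=> k l; rewrite QaQ submxblock0.
have [->|] := eqVneq k i; last by rewrite !mul0mx.
by have [->|] := eqVneq l j; rewrite ?mulmx0 // a0 mulmx0 mul0mx.
Qed.

Definition conj_map m p (V : 'M[C]_(m, p)) (a : 'M[C]_p) : 'M[C]_m :=
  V *m a *m V^t*.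

Lemma conj_map_linear m p (V : 'M[C]_(m, p)) : linear (conj_map V).
Proof.
by move=> c a b; rewrite /conj_map mulmxDr mulmxDl -scalemxAr -scalemxAl.
Qed.
HB.instance Definition _ m p (V : 'M[C]_(m, p)) :=
  GRing.isLinear.Build _ _ _ _ (conj_map V) (conj_map_linear V).

Lemma conj_mapM m p (V : 'M[C]_(m, p)) : V^t* *m V = 1%:M ->
  {morph conj_map V : a b / a *m b}.
Proof.
move=> VV a b; rewrite /conj_map !mulmxA; congr (_ *m _ *m _).
by rewrite -[RHS]mulmxA VV mulmx1.
Qed.

Lemma conj_map_adj m p (V : 'M[C]_(m, p)) : {morph conj_map V : a / a^t*}.
Proof. by move=> a; rewrite /conj_map !adjmxM adjmxK mulmxA. Qed.

(** * Multiplicity one homomorphisms as conjugations *)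

Lemma unit_multiple p (u : 'cV[C]_p) : u != 0 ->
  exists c : C, (c *: u)^t* *m (c *: u) = 1%:M.
Proof.
move=> u0; pose s := \sum_k `|u k 0| ^+ 2.
have s_ge0 : 0 <= s by apply: sumr_ge0 => k _; rewrite exprn_ge0.
have s_neq0 : s != 0.
  apply: contra u0 => /eqP/psumr_eq0P s0; apply/eqP/colP=> k; rewrite mxE.
  by apply/eqP; rewrite -normr_eq0 -sqrf_eq0 s0 // => j _; rewrite exprn_ge0.
exists (sqrtC s)^-1; apply/matrixP=> i j; rewrite !ord1 !mxE eqxx.
transitivity ((sqrtC s)^-1 ^+ 2 * s); last by rewrite exprVn sqrtCK mulVf.
rewrite mulr_sumr; apply: eq_bigr => k _.
rewrite !mxE rmorphM /= (@geC0_conj _ (sqrtC s)^-1) ?invr_ge0 ?sqrtC_ge0 //.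
by rewrite mulrACA -expr2 [X in _ * X]mulrC normCK.
Qed.

(** A normalised nonzero column [v] of [q] is fixed by [q], so [v *m v^t*] is a projection below
    [q]. The difference is idempotent of trace 1 - 1 = 0, hence zero, since the rank of an
    idempotent is its trace. *)
Lemma rank1_projection_dyad p (q : 'M[C]_p) : projection q -> \rank q = 1%N ->
  exists2 v : 'cV[C]_p, v^t* *m v = 1%:M & q = v *m v^t*.
Proof.
move=> [qq qa] rq.
have [j qj] : exists j, col j q != 0.
  have [j qj|q0] := pickP (fun j => col j q != 0); first by exists j.
  suff q00 : q = 0 by rewrite q00 mxrank0 in rq.
  by apply/matrixP=> i j; have /negbFE/eqP/colP/(_ i) := q0 j; rewrite !mxE.
have [c] := unit_multiple qj; set v := c *: _ => vv.
have qv : q *m v = v by rewrite /v -scalemxAr !colE mulmxA qq.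
exists v => //; set d := v *m v^t*.
have dd : d *m d = d by rewrite mulmxA -[X in X *m _]mulmxA vv mulmx1.
have qd : q *m d = d by rewrite mulmxA qv.
have dq : d *m q = d.
  by rewrite -[q]qa -mulmxA -adjmxM qv.
have idem : (q - d) *m (q - d) = q - d.
  by rewrite mulmxBl !mulmxBr qq qd dq dd subrr subr0.
have := mxtrace_idem idem; rewrite raddfB /= !mxtrace_idem // rq.
rewrite -(mxtrace_idem dd) mxtrace_mulC vv mxtrace1 subrr => /esym/eqP.
by rewrite pnatr_eq0 mxrank_eq0 subr_eq0 => /eqP.
Qed.

(* Every *-homomorphism of multiplicity one between full matrix algebras is a
   conjugation by an isometry V: its columns are the images of a unit vector v in
   the range of Phi(E_00) under the partial isometries Phi(E_i0). *)
Lemma multiplicity_one_conj m p (i0 : 'I_m) (Phi : {linear 'M[C]_m -> 'M[C]_p}) :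
    {morph Phi : a b / a *m b} -> {morph Phi : a / a^t*} ->
    (forall q, projection q -> \rank q = 1%N -> \rank (Phi q) = 1%N) ->
  exists2 V : 'M[C]_(p, m), V^t* *m V = 1%:M & forall a, Phi a = conj_map V a.
Proof.
move=> PhiM PhiA PhiR.
have dadj (i j : 'I_m) : (delta_mx i j : 'M[C]_m)^t* = delta_mx j i.
  by apply/matrixP=> k l; rewrite !mxE andbC rmorph_nat.
set q := Phi (delta_mx i0 i0).
have dmul i j k l : Phi (delta_mx i j) *m Phi (delta_mx k l)
    = if j == k then Phi (delta_mx i l) else 0.
  rewrite -PhiM; case: eqP => [->|/eqP jk]; first by rewrite mul_delta_mx.
  by rewrite mul_delta_mx_0 // raddf0.
have qq : q *m q = q by rewrite dmul eqxx.
have qa : q^t* = q by rewrite -PhiA dadj.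
have rq : \rank q = 1%N.
  apply: PhiR; last by rewrite mxrank_delta.
  by split; [rewrite mul_delta_mx | rewrite dadj].
have [v vv qv] := rank1_projection_dyad (Logic.conj qq qa) rq.
pose V : 'M[C]_(p, m) := \matrix_(k, i) (Phi (delta_mx i i0) *m v) k 0.
have cV i : col i V = Phi (delta_mx i i0) *m v.
  by apply/colP=> k; rewrite !mxE.
have rV i : row i (V^t*) = v^t* *m Phi (delta_mx i0 i).
  rewrite -[delta_mx i0 i]adjmxK dadj PhiA -adjmxM -cV.
  by apply/rowP=> k; rewrite !mxE.
have qvv : q *m v = v by rewrite qv -mulmxA vv mulmx1.
exists V.
  apply/matrixP=> i j.
  rewrite -[LHS](_ : (row i (V^t*) *m col j V) 0 0 = _); last first.
    by rewrite !mxE; apply: eq_bigr => k _; rewrite !mxE.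
  rewrite rV cV mulmxA -[X in X *m v]mulmxA dmul.
  rewrite [RHS]mxE; case: eqP => _; last by rewrite mulmx0 mul0mx mxE.
  by rewrite -mulmxA -/q qvv vv mxE eqxx.
move=> a; rewrite [a]matrix_sum_delta !raddf_sum; apply: eq_bigr => i _.
rewrite !raddf_sum; apply: eq_bigr => j _.
rewrite /= !linearZ; congr (_ *: _).
rewrite /= /conj_map.
rewrite (_ : V *m delta_mx i j = col i V *m delta_mx 0 j); last first.
  by rewrite colE -mulmxA mul_delta_mx.
rewrite -mulmxA -rowE cV rV mulmxA -[X in X *m _]mulmxA -qv /q.
by do 2!rewrite dmul eqxx.
Qed.


(** * Families of isometries that permute the blocks *)

Record conj_family n n' (I : finType) (theta : I -> 'S_4)
    (V : I -> 'M[C]_(\sum_k n' k, \sum_k n k)) : Prop := ConjFamily {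
  conj_family_sides : forall s, respects_sides (theta s);
  conj_family_Q : forall s i, Qmx n' (theta s i) *m V s = V s *m Qmx n i;
  conj_family_adj : forall s t, (V s)^t* *m V t = if s == t then 1%:M else 0
}.

Definition conj_sum n n' (phi : embedding R n n') (I : finType)
    (V : I -> 'M[C]_(\sum_k n' k, \sum_k n k)) : Prop :=
  forall a : cycle4 R n, phi a = \sum_s conj_map (V s) a :> 'M[C]_(\sum_k n' k).

(** Any finite index type is allowed, so that a composite can be indexed by pairs and a single
    isometry by [unit]. *)
Definition has_types n n' (phi : embedding R n n') (I : finType)
    (theta : I -> 'S_4) : Prop :=
  exists2 V : I -> 'M[C]_(\sum_k n' k, \sum_k n k),
    conj_family theta V & conj_sum phi V.

Section Family.
Variables (n n' : 'I_4 -> nat) (I : finType) (theta : I -> 'S_4).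
Variable V : I -> 'M[C]_(\sum_k n' k, \sum_k n k).
Hypothesis HV : conj_family theta V.

Lemma conj_family_Qadj s i :
  (V s)^t* *m Qmx n' (theta s i) = Qmx n i *m (V s)^t*.
Proof. by rewrite -[Qmx n' _]Qmx_adj -adjmxM (conj_family_Q HV) adjmxM Qmx_adj. Qed.

Lemma conj_map_Q s a i j :
  conj_map (V s) (Qmx n i *m a *m Qmx n j) =
  Qmx n' (theta s i) *m conj_map (V s) a *m Qmx n' (theta s j).
Proof.
rewrite /conj_map -!mulmxA conj_family_Qadj !mulmxA.
by rewrite (conj_family_Q HV).
Qed.

(** Conjugation moves block [(i, j)] to [(theta s i, theta s j)]. As [theta s] respects the sides, a
    forbidden block of the image comes from a forbidden block of [a]. *)
Lemma conj_map_cycle4 s a : a \in @cycle4_pred R n ->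
  conj_map (V s) a \in @cycle4_pred R n'.
Proof.
move=> /cycle4_predP aP; apply/cycle4_predP=> i j ij; apply/Qmx_block0.
rewrite -(permKV (theta s) i) -(permKV (theta s) j) -conj_map_Q.
rewrite (Qmx_block0 _ _ _).1 ?raddf0 //; apply: aP; apply: contra ij.
rewrite /cycle4_entry (inj_eq perm_inj) => /orP[->//|].
have E k : ((theta s)^-1%g k < 2)%N = (k < 2)%N.
  by rewrite -(conj_family_sides HV s) permKV.
by rewrite (leqNgt 2) [X in _ || X]andbC (leqNgt 2) !E andbC => ->; rewrite orbT.
Qed.

Definition conj_family_fun (a : cycle4 R n) : cycle4 R n' :=
  \sum_s Cycle4 (conj_map_cycle4 s (valP a)).

Lemma conj_family_funE a :
  conj_family_fun a = \sum_s conj_map (V s) a :> 'M[C]_(\sum_k n' k).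
Proof. by rewrite cycle4_mx_sum. Qed.

Lemma conj_family_fun_linear : linear conj_family_fun.
Proof.
move=> c a b; apply: val_inj.
change (cycle4_mx (conj_family_fun (c *: a + b)) =
  c *: cycle4_mx (conj_family_fun a) + cycle4_mx (conj_family_fun b)).
rewrite !conj_family_funE scaler_sumr -big_split; apply: eq_bigr => s _.
exact: (conj_map_linear (V s)).
Qed.
HB.instance Definition _ :=
  GRing.isLinear.Build _ _ _ _ conj_family_fun conj_family_fun_linear.

Lemma conj_map_mulE s t a b : conj_map (V s) a *m conj_map (V t) b =
  if s == t then conj_map (V s) (a *m b) else 0.
Proof.
rewrite /conj_map !mulmxA -(mulmxA _ (_^t*)) (conj_family_adj HV).
case: eqP => [->|_]; last by rewrite mulmx0 !mul0mx.
by rewrite mulmx1 -!mulmxA.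
Qed.

Lemma conj_family_funM : {morph conj_family_fun : a b / a * b}.
Proof.
move=> a b; apply: val_inj.
change (cycle4_mx (conj_family_fun (a * b)) =
  cycle4_mx (conj_family_fun a) *m cycle4_mx (conj_family_fun b)).
rewrite !conj_family_funE mulmx_suml; apply: eq_bigr => s _.
rewrite mulmx_sumr (bigD1 s) //= conj_map_mulE eqxx [X in _ = _ + X]big1 => [|t /negPf ts].
  by rewrite addr0.
by rewrite conj_map_mulE eq_sym ts.
Qed.

(** Compressing the sum with any one [V s] kills the other summands and recovers the argument. *)
Lemma conj_family_fun_inj : (0 < #|I|)%N -> injective conj_family_fun.
Proof.
case/card_gt0P=> s _ a b /(congr1 (@cycle4_mx R n')).
rewrite !conj_family_funE => /(congr1 (fun x => (V s)^t* *m x *m V s)).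
have E x : (V s)^t* *m (\sum_t conj_map (V t) x) *m V s = x.
  rewrite mulmx_sumr mulmx_suml (bigD1 s) //= [X in _ + X]big1 => [|t /negPf ts].
    rewrite addr0 /conj_map !mulmxA (conj_family_adj HV) eqxx mul1mx.
    by rewrite -mulmxA (conj_family_adj HV) eqxx mulmx1.
  by rewrite /conj_map !mulmxA (conj_family_adj HV) eq_sym ts !mul0mx.
by rewrite !E => /val_inj.
Qed.

Lemma conj_family_embedding : (0 < #|I|)%N ->
  exists phi : embedding R n n', conj_sum phi V.
Proof.
move=> I_gt0; exists (@Embedding _ n n' conj_family_fun conj_family_funM
  (conj_family_fun_inj I_gt0)) => a.
exact: conj_family_funE.
Qed.

End Family.

(** * Rigid embeddings correspond to families of isometries *)

Lemma mxtrace_conj_map m p (W : 'M[C]_(m, p)) (a : 'M[C]_p) :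
  W^t* *m W = 1%:M -> \tr (conj_map W a) = \tr a.
Proof. by move=> WW; rewrite /conj_map mxtrace_mulC mulmxA WW mul1mx. Qed.

Lemma has_types_rigid_sum n n' (phi : embedding R n n') (I : finType)
    (theta : I -> 'S_4) :
  has_types phi theta -> rigid_sum phi [seq theta s | s <- enum I].
Proof.
case=> V HV phiV.
have ex s : {psi : embedding R n n' |
    forall a, psi a = conj_map (V s) a :> 'M[C]_(\sum_k n' k)}.
  apply: cid.
  (* A single member of the family is itself a family over [unit], which makes each summand an
     embedding. *)
  have HVs : conj_family (fun _ : unit => theta s) (fun _ => V s).
    split=> [_|_ i|[] []]; first exact: (conj_family_sides HV).
      exact: (conj_family_Q HV).
    by rewrite (conj_family_adj HV) eqxx.
  have [|psi psiE] := conj_family_embedding HVs; first by rewrite card_unit.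
  by exists psi => a; rewrite psiE big_const card_unit /= addr0.
set ts := map _ _.
have sz : size ts = #|I| by rewrite size_map -cardE.
pose e (k : 'I_(size ts)) : I := enum_val (cast_ord sz k).
have e_inj : injective e by move=> k l /enum_val_inj/cast_ord_inj.
have tsE k : tnth (in_tuple ts) k = theta (e k).
  rewrite (tnth_nth 1%g) /= (nth_map (e k)); last by rewrite -cardE -sz ltn_ord.
  by congr (theta _); rewrite /e /enum_val; apply: set_nth_default; rewrite -cardE -sz ltn_ord.
exists (fun k => sval (ex (e k))); split=> [k|k l kl a b|a].
- rewrite tsE; case: (ex (e k)) => psi psiE /=.
  have VV : (V (e k))^t* *m V (e k) = 1%:M by rewrite (conj_family_adj HV) eqxx.
  split; last 1 first.
  + move=> i j _ [_ [a _ <-] <-]; exists (psi a) => //; apply: val_inj.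
    transitivity (Qmx n' (theta (e k) i) *m psi a *m Qmx n' (theta (e k) j)) => //.
    by rewrite psiE -(conj_map_Q HV) -(psiE (Q R n i * a * Q R n j)).
  + exists (conj_map (V (e k))).
      split; [exact: conj_mapM | exact: conj_map_adj | by move=> a; rewrite psiE].
    (* Conjugation by an isometry preserves the trace, which on idempotents is the rank. *)
    move=> p [pp pa] rp; apply/eqP; rewrite -(eqr_nat C) -!mxtrace_idem //.
      by rewrite mxtrace_conj_map // mxtrace_idem // rp.
    by rewrite -conj_mapM // pp.
  exact: (conj_family_sides HV).
- case: (ex (e k)) => psi psiE; case: (ex (e l)) => psi' psiE' /=.
  apply: val_inj; transitivity (cycle4_mx (psi a) *m psi' b) => //.
  rewrite psiE psiE' (conj_map_mulE HV).
  by rewrite (inj_eq e_inj) (negPf kl).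
apply: val_inj; apply: etrans (phiV a) (etrans _ (esym (cycle4_mx_sum _))).
rewrite (reindex e) /=; last first.
  by apply: onW_bij; apply: inj_card_bij => //; rewrite card_ord sz.
by apply: eq_bigr => k _; case: (ex (e k)).
Qed.

Lemma rigid_sum_has_types n n' (phi : embedding R n n') ts :
    (forall i, 0 < n i)%N -> rigid_sum phi ts ->
  has_types phi (tnth (in_tuple ts)).
Proof.
move=> n_gt0 [psi [psiR psiO phiE]].
have i0 : 'I_(\sum_i n i).
  by apply: (Ordinal (n := (\sum_i n i)%N) (m := 0)); rewrite (bigD1 0) //= addn_gt0 n_gt0.
have ex s : {V : 'M[C]_(\sum_k n' k, \sum_k n k) | V^t* *m V = 1%:M /\
    forall a, psi s a = conj_map V a :> 'M[C]_(\sum_k n' k)}.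
  apply: cid; have [[Phi [PhiM PhiA PhiE] PhiR] _ _] := psiR s.
  have [V VV PhiV] := multiplicity_one_conj i0 PhiM PhiA PhiR.
  by exists V; split=> // a; rewrite -PhiE PhiV.
pose V s := sval (ex s).
have VV s : (V s)^t* *m V s = 1%:M by have [] := svalP (ex s).
have psiV s a : psi s a = conj_map (V s) a :> 'M[C]_(\sum_k n' k).
  by have [_] := svalP (ex s); apply.
exists V; last by move=> a; rewrite phiE cycle4_mx_sum; apply: eq_bigr => s _.
split=> [s|s i|s t]; first by have [] := psiR s.
  set th := tnth _ s.
  (* The image of [Q j] lies in the corner of [Q (th j)], so left multiplication by the latter fixes
     it; multiplying on the right by [V s] turns this into a relation for the isometry. *)
  have QVQ j : Qmx n' (th j) *m V s *m Qmx n j = V s *m Qmx n j.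
    have [b bE] : exists b, Q R n' (th j) * b * Q R n' (th j) = psi s (Q R n j).
      have [_ _ /(_ j j (psi s (Q R n j)))[|b _ bE]] := psiR s; last by exists b.
      by exists (Q R n j) => //; exists (Q R n j); rewrite // !mulQQ eqxx mulQQ eqxx.
    have : Q R n' (th j) * psi s (Q R n j) = psi s (Q R n j).
      by rewrite -bE !mulrA mulQQ eqxx.
    move/(congr1 (@cycle4_mx R n')) => e.
    have {}e : Qmx n' (th j) *m conj_map (V s) (Qmx n j) = conj_map (V s) (Qmx n j).
      by rewrite -psiV.
    move/(congr1 (fun x => x *m V s)): e; rewrite /conj_map -!mulmxA VV !mulmx1.
    by [].
  (* Insert [1 = \sum_j Q j] after [V s]: for [j != i] the range of [V s *m Qmx n j] lies in a block
     other than [th i], so only [i] remains. *)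
  rewrite -[V s in LHS]mulmx1 -(sum_Qmx n) mulmx_sumr mulmx_sumr [LHS](bigD1 i) //=.
  rewrite mulmxA QVQ [X in _ + X]big1 ?addr0 // => j ji.
  rewrite -QVQ !mulmxA QmxM (inj_eq perm_inj) eq_sym (negPf ji) !mul0mx.
  by [].
have [->|st] := eqVneq; first exact: VV.
(* The range projections of [V s] and [V t] have product zero; compressing it by the isometries
   leaves [(V s)^t* *m V t]. *)
have /(congr1 val) := psiO _ _ st 1 1.
rewrite /= !psiV /conj_map !mulmx1 => /(congr1 (fun x => (V s)^t* *m x *m V t)).
by rewrite mulmx0 mul0mx !mulmxA VV mul1mx -mulmxA VV mulmx1.
Qed.

Lemma conj_map_comp m p q (V : 'M[C]_(m, p)) (W : 'M[C]_(p, q)) a :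
  conj_map V (conj_map W a) = conj_map (V *m W) a.
Proof. by rewrite /conj_map adjmxM !mulmxA. Qed.

(** Products of isometries realise the composite. A product of permutations applies its left factor
    first, hence the order of the factors. *)
Lemma has_types_comp n n' n'' (psi : embedding R n' n'') (phi : embedding R n n')
    (I J : finType) (theta : I -> 'S_4) (theta' : J -> 'S_4) :
    has_types phi theta -> has_types psi theta' ->
  has_types (comp_emb psi phi) (fun s : I * J => (theta s.1 * theta' s.2)%g).
Proof.
case=> V HV phiV [W HW psiW]; exists (fun s => W s.2 *m V s.1).
  split=> [s i|s i|[s t] [s' t']] /=.
  - by rewrite permM (conj_family_sides HW) (conj_family_sides HV).
  - rewrite permM mulmxA (conj_family_Q HW) -[LHS]mulmxA (conj_family_Q HV).
    exact: mulmxA.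
  rewrite adjmxM -mulmxA (mulmxA _ (W t')) (conj_family_adj HW) xpair_eqE andbC.
  by case: eqP => _; rewrite ?mul1mx ?(conj_family_adj HV) // mul0mx mulmx0.
move=> a; transitivity (cycle4_mx (psi (phi a))) => //.
rewrite psiW phiV -(pair_bigA _ (fun s t => conj_map (W t *m V s) a)) /= exchange_big.
apply: eq_bigr => t _; rewrite raddf_sum; apply: eq_bigr => s _.
exact: conj_map_comp.
Qed.

(** * K_0 and H_1 read off from the types *)

Lemma tr_submxblock n (x : 'M[C]_(\sum_k n k)) j :
  \tr (submxblock x j j) = \tr (Qmx n j *m x).
Proof.
rewrite -{2}[x]submxblockK mul_mxdiag_mxblock mxtrace_mxblock (bigD1 j) //=.
rewrite eqxx mul1mx big1 ?addr0 // => k /negPf->.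
by rewrite mul0mx mxtrace0.
Qed.

(** The entry [(i, j)] is the rank of an idempotent, hence a trace, hence additive over the
    summands; the summand [s] contributes 1 exactly when [theta s i = j]. *)
Lemma K0_mx_types n n' (phi : embedding R n n') (I : finType) (theta : I -> 'S_4) :
    (forall i, 0 < n i)%N -> has_types phi theta ->
  K0_mx phi = \sum_s perm_mx (theta s).
Proof.
move=> n_gt0 [V HV phiV]; apply/matrixP=> i j; rewrite summxE !mxE.
set e := min_proj R n i.
have pp : (pid_mx 1 : 'M[C]_(n i)) *m (pid_mx 1 : 'M[C]_(n i)) = pid_mx 1.
  exact: pid_mx_id.
have ee : e * e = e by rewrite /e min_projE -diag_blockM pp.
have tre k : \tr (submxblock e k k) = (k == i)%:R.
  rewrite submxblock_diag; case: eqP => [->|_]; last exact: mxtrace0.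
  by rewrite mxtrace_idem // rank_pid_mx.
apply/eqP; rewrite -(eqr_int C); apply/eqP.
transitivity (\tr (submxblock (phi e) j j)).
  by rewrite mxtrace_idem // -submxblockM_diag -embM ee.
rewrite tr_submxblock phiV mulmx_sumr raddf_sum raddf_sum; apply: eq_bigr => s _ /=.
rewrite -[in LHS](permKV (theta s) j) /conj_map !mulmxA (conj_family_Q HV).
rewrite mxtrace_mulC !mulmxA (conj_family_adj HV) eqxx mul1mx -tr_submxblock tre.
rewrite -(inj_eq (@perm_inj _ (theta s))) permKV !mxE eq_sym.
by case: eqP.
Qed.

Lemma K0_comp n n' n'' (psi : embedding R n' n'') (phi : embedding R n n')
    (I J : finType) (theta : I -> 'S_4) (theta' : J -> 'S_4) :
    (forall i, 0 < n i)%N -> (forall i, 0 < n' i)%N ->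
    has_types phi theta -> has_types psi theta' ->
  forall x, K0 (comp_emb psi phi) x = K0 psi (K0 phi x).
Proof.
move=> n_gt0 n'_gt0 phiT psiT x; rewrite /= -mulmxA; congr (_ *m _).
rewrite (K0_mx_types n_gt0 phiT) (K0_mx_types n'_gt0 psiT).
rewrite (K0_mx_types n_gt0 (has_types_comp phiT psiT)).
rewrite -(pair_bigA _ (fun s t => perm_mx (theta s * theta' t)%g)) mulmx_suml.
apply: eq_bigr => s _; rewrite mulmx_sumr; apply: eq_bigr => t _.
exact: perm_mxM.
Qed.

Lemma tau_values :
  [/\ tau12 (inord 0) = inord 1, tau12 (inord 2) = inord 2,
      tau34 (inord 0) = inord 0, tau34 (inord 2) = inord 3 &
      tau34 (inord 1) = inord 1].
Proof.
rewrite /tau12 /tau34.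
by split; rewrite ?tpermL // tpermD // -val_eqE /= !inordK.
Qed.

Lemma respects_sides_tau12 : respects_sides tau12.
Proof. by move=> i; rewrite /tau12; case: tpermP => [->|->|]; rewrite ?inordK. Qed.

Lemma respects_sides_tau34 : respects_sides tau34.
Proof. by move=> i; rewrite /tau34; case: tpermP => [->|->|]; rewrite ?inordK. Qed.

(** A permutation respecting the sides is determined by its values at 0 and 2, so it is one of four;
    the identity and [tau12 * tau34] are the even ones. In terms of signs, H_1 is visibly
    multiplicative. *)
Lemma respects_sides_sign (theta : 'S_4) : respects_sides theta ->
  ((theta == 1%g) + (theta == (tau12 * tau34)%g))%:Z
    - ((theta == tau12) + (theta == tau34))%:Z = (-1) ^+ odd_perm theta :> int.
Proof.
move=> sides; have [a0 a2 b0 b2 b1] := tau_values.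
have sides1 : respects_sides 1%g by move=> i; rewrite perm1.
have sides1234 : respects_sides (tau12 * tau34)%g.
  by move=> i; rewrite permM respects_sides_tau34 respects_sides_tau12.
have odd12 : odd_perm tau12 by rewrite odd_tperm -val_eqE /= !inordK.
have odd34 : odd_perm tau34 by rewrite odd_tperm -val_eqE /= !inordK.
pose eqs := (pres_inj sides sides1, pres_inj sides sides1234,
  pres_inj sides respects_sides_tau12, pres_inj sides respects_sides_tau34).
have vals := (permM, perm1, a0, a2, b0, b1, b2).
have E : [|| theta == 1%g, theta == (tau12 * tau34)%g, theta == tau12 | theta == tau34].
  rewrite !eqs !vals -!val_eqE /= !inordK //.
  have := sides (inord 0); have := sides (inord 2); rewrite !inordK //.
  case: (theta (inord 0)) => [[|[|[|[]]]]] //= _;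
  by case: (theta (inord 2)) => [[|[|[|[]]]]].
by case/or4P: E => /eqP E; rewrite !eqs E !vals -!val_eqE /= !inordK //= ?odd_permM
  ?odd12 ?odd34 ?odd_perm1.
Qed.

Lemma H1_degree_sign (ts : seq 'S_4) : {in ts, forall theta, respects_sides theta} ->
  H1_degree ts = \sum_(theta <- ts) (-1) ^+ odd_perm theta.
Proof.
elim: ts => [|t ts IH] tsP; first by rewrite big_nil.
rewrite big_cons -IH => [|u uts]; last by apply: tsP; rewrite inE uts orbT.
rewrite -respects_sides_sign; last by apply: tsP; rewrite inE eqxx.
by rewrite /H1_degree /= !PoszD; ring.
Qed.

Lemma H1_types n n' (phi : embedding R n n') (I : finType) (theta : I -> 'S_4) :
    (forall i, 0 < n i)%N -> has_types phi theta ->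
  H1 phi = \sum_s (-1) ^+ odd_perm (theta s).
Proof.
move=> n_gt0 phiT; rewrite (H1E n_gt0 (has_types_rigid_sum phiT)) H1_degree_sign.
  by rewrite big_map big_enum.
by case: phiT => V HV _ t /mapP[s _ ->]; apply: (conj_family_sides HV).
Qed.

Lemma H1_comp n n' n'' (psi : embedding R n' n'') (phi : embedding R n n')
    (I J : finType) (theta : I -> 'S_4) (theta' : J -> 'S_4) :
    (forall i, 0 < n i)%N -> (forall i, 0 < n' i)%N ->
    has_types phi theta -> has_types psi theta' ->
  H1 (comp_emb psi phi) = H1 psi * H1 phi.
Proof.
move=> n_gt0 n'_gt0 phiT psiT.
rewrite (H1_types n_gt0 phiT) (H1_types n'_gt0 psiT).
rewrite (H1_types n_gt0 (has_types_comp phiT psiT)) mulrC.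
rewrite -(pair_bigA _ (fun s t => (-1) ^+ (theta s * theta' t)%g)) mulr_suml.
apply: eq_bigr => s _; rewrite mulr_sumr; apply: eq_bigr => t _.
by rewrite odd_permM signr_addb.
Qed.

(** * Recombining isometries, and a starting embedding of A(D_4) *)

(* The isometry s of the new family is V (pi s) on the blocks {1, 2} and
   V (rho s) on the blocks {3, 4}. *)
Lemma conj_family_splice n n' (I J : finType) (theta : I -> 'S_4)
    (V : I -> 'M[C]_(\sum_k n' k, \sum_k n k)) (theta' : J -> 'S_4)
    (pi rho : J -> I) :
    conj_family theta V -> injective pi -> injective rho ->
    (forall s, respects_sides (theta' s)) ->
    (forall s (i : 'I_4), theta' s i = theta ((if i < 2 then pi else rho) s)%N i) ->
  conj_family theta'
    (fun s => \sum_(i < 4) V ((if i < 2 then pi else rho) s)%N *m Qmx n i).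
Proof.
move=> HV pi_inj rho_inj sides' theta'E.
set sel := fun (i : 'I_4) => if (i < 2)%N then pi else rho.
have sel_inj i : injective (sel i) by rewrite /sel; case: ifP.
have VQ s i : V (sel i s) *m Qmx n i
    = Qmx n' (theta' s i) *m (V (sel i s) *m Qmx n i).
  by rewrite mulmxA theta'E (conj_family_Q HV) -mulmxA QmxM eqxx.
split=> // [s i|s t].
  rewrite mulmx_sumr mulmx_suml [LHS](bigD1 i) //= [RHS](bigD1 i) //=.
  rewrite -(VQ s i) -[in RHS]mulmxA QmxM eqxx.
  rewrite [X in _ + X = _]big1 => [|k ki].
    rewrite [X in _ = _ + X]big1 // => k ki.
    by rewrite -mulmxA QmxM (negPf ki) mulmx0.
  by rewrite (VQ s k) [LHS]mulmxA QmxM (inj_eq perm_inj) eq_sym (negPf ki) mul0mx.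
rewrite (_ : _^t* = \sum_(i < 4) Qmx n i *m (V (sel i s))^t*); last first.
  rewrite (raddf_sum trmx) (raddf_sum (map_mx Num.conj)).
  by apply: eq_bigr => i _; rewrite [LHS]adjmxM Qmx_adj.
rewrite mulmx_suml.
(* A fixed block uses one selector throughout, whose injectivity carries over the orthogonality of
   [V]. *)
have diag i : Qmx n i *m (V (sel i s))^t* *m (V (sel i t) *m Qmx n i)
    = if s == t then Qmx n i else 0.
  rewrite mulmxA -(mulmxA (Qmx n i)) (conj_family_adj HV) (inj_eq (@sel_inj i)).
  by case: eqP; rewrite ?mulmx1 ?mulmx0 ?mul0mx // QmxM eqxx.
have offdiag i k : k != i ->
    Qmx n i *m (V (sel i s))^t* *m (V (sel k t) *m Qmx n k) = 0.
  (* Blocks on the same side share a selector, so orthogonality comes from [V] and [Qmx]. Blocks on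
     different sides are sent to different sides, so the ranges are orthogonal. *)
  move=> ki; have [ik|ik] := eqVneq (i < 2)%N (k < 2)%N.
    have -> : sel k = sel i by rewrite /sel ik.
    rewrite mulmxA -(mulmxA (Qmx n i)) (conj_family_adj HV).
    case: eqP; rewrite ?mulmx1 ?mulmx0 ?mul0mx // QmxM eq_sym.
    by rewrite (negPf ki).
  have -> : Qmx n i *m (V (sel i s))^t* = (V (sel i s) *m Qmx n i)^t*.
    by rewrite adjmxM Qmx_adj.
  rewrite VQ adjmxM Qmx_adj (VQ t k) -mulmxA (mulmxA (Qmx n' _)) QmxM.
  case: eqP => [e|_]; last by rewrite mul0mx mulmx0.
  by rewrite -(sides' s i) -(sides' t k) e eqxx in ik.
transitivity (\sum_i (if s == t then Qmx n i else 0 : 'M[C]_(\sum_k n k))).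
  apply: eq_bigr => i _; rewrite mulmx_sumr [LHS](bigD1 i) //= diag.
  by rewrite [X in _ + X]big1 ?addr0 // => k; apply: offdiag.
by case: (s == t); [exact: sum_Qmx | exact: big1].
Qed.

(** Each diagonal block of [V] is a first standard unit vector. This supplies an element of the
    joint scale with homology component 1. *)
Lemma base_embedding n : (forall i, 0 < n i)%N ->
  exists phi : embedding R D4 n, has_types phi (fun _ : unit => 1%g).
Proof.
move=> n_gt0.
pose V : 'M[C]_(\sum_k n k, \sum_k D4 k) :=
  \mxblock_(i, j) (if i == j then pid_mx 1 else 0).
have HV : conj_family (fun _ : unit => 1%g) (fun _ => V).
  split=> [_ i|_ i|[] []]; first by rewrite perm1.
    rewrite perm1 mul_mxdiag_mxblock mul_mxblock_mxdiag; apply/mxblockP=> k l.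
    rewrite !mxblockK; have [<-|] := eqVneq k l; last by rewrite mul0mx mulmx0.
    by case: eqP => _; rewrite ?mul0mx ?mulmx0 ?mul1mx ?mulmx1.
  rewrite eqxx.
  have -> : V^t* = \mxblock_(i, j) (if i == j then pid_mx 1 else 0).
    apply/mxblockP=> k l; rewrite mxblockK.
    transitivity ((submxblock V l k)^t*); first by apply/matrixP=> i j; rewrite !mxE.
    rewrite mxblockK eq_sym; case: eqP => _; last by rewrite trmx0 map_mx0.
    by rewrite tr_pid_mx map_pid_mx.
  rewrite mul_mxblock; apply/mxblockP=> k l; rewrite mxblockK.
  rewrite (_ : 1%:M = \mxdiag_i (1%:M : 'M[C]_(D4 i))); last by rewrite mxdiagZ.
  rewrite (bigD1 k) //= eqxx big1 ?addr0 => [|j /negPf jk]; last first.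
    by rewrite eq_sym jk mul0mx.
  have [<-|kl] := eqVneq k l; last by rewrite submxblock_mxdiagN // mulmx0.
  rewrite submxblock_diag pid_mx_id //.
  by rewrite pid_mx_1.
have [|phi phiV] := conj_family_embedding HV; first by rewrite card_unit.
by exists phi; exists (fun _ => V).
Qed.

Lemma K0_class_D4 : K0_class (Q R D4 (inord 0) + Q R D4 (inord 2))
  = delta_mx 0 (inord 0) + delta_mx 0 (inord 2).
Proof.
apply/rowP=> i; rewrite !mxE /= submxblockD !submxblock_diag.
have [->|i0] := eqVneq i (inord 0).
  by rewrite -val_eqE /= !inordK //= !addr0 mxrank1.
have [->|i2] := eqVneq i (inord 2).
  by rewrite add0r mxrank1.
by rewrite addr0 mxrank0.
Qed.

End Conjugation.

(** * Composites of the system and passage to later stages *)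

Section Limit.
Variables (R : realType) (S : generic_system R).

Lemma alpha_types k : exists (I : finType) (theta : I -> 'S_4),
  has_types (alpha S k) theta.
Proof.
have [ts ts_sum _] := alpha_generic S k.
exists 'I_(size ts), (tnth (in_tuple ts)).
exact: rigid_sum_has_types (bsize_gt0 S k) ts_sum.
Qed.

Lemma alpha_comp_types i m : exists (I : finType) (theta : I -> 'S_4),
  has_types (alpha_comp S i m) theta.
Proof.
elim: m => [|m [I [theta phiT]]]; first exact: alpha_types.
have [J [theta' psiT]] := alpha_types (m + i).+1.
exists (I * J)%type, (fun s => (theta s.1 * theta' s.2)%g).
exact: has_types_comp.
Qed.

Lemma alpha_comp_K0 i m x :
  K0 (alpha_comp S i m) x = push (K0_maps S) i m.+1 x.
Proof.
elim: m => [//|m IH].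
have [I [theta phiT]] := alpha_comp_types i m.
have [J [theta' psiT]] := alpha_types (m + i).+1.
by rewrite -[push _ _ _ _]/(K0 (alpha S (m + i).+1) (push (K0_maps S) i m.+1 x))
  -IH -(K0_comp _ _ phiT psiT) //; apply: bsize_gt0.
Qed.

Lemma alpha_comp_H1 i m x :
  H1 (alpha_comp S i m) * x = push (H1_maps S) i m.+1 x.
Proof.
elim: m => [//|m IH].
have [I [theta phiT]] := alpha_comp_types i m.
have [J [theta' psiT]] := alpha_types (m + i).+1.
by rewrite -[push _ _ _ _]/(H1 (alpha S (m + i).+1) * push (H1_maps S) i m.+1 x)
  -IH mulrA -(H1_comp _ _ phiT psiT) //; apply: bsize_gt0.
Qed.

(** Allows an embedding of A(D_4) to be moved to a later stage; [i < l] is strict because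
    [alpha_comp] has at least one factor. *)
Lemma push_D4 i l (phi : embedding R D4 (bsize S i)) (I : finType) (theta : I -> 'S_4) :
    has_types phi theta -> (i < l)%N ->
  exists (J : finType) (theta' : J -> 'S_4) (psi : embedding R D4 (bsize S l)),
    [/\ has_types psi theta',
        forall x, K0 psi x = trans (K0_maps S) i l (K0 phi x) &
        H1 psi = trans (H1_maps S) i l (H1 phi)].
Proof.
move=> phiT il; have [J [theta' alphaT]] := alpha_comp_types i (l - i.+1).
(* The type of [psi] depends on the target stage, so this stage is kept in the form produced by
   [alpha_comp] and rewritten to [l] only at the end. *)
have : exists (J : finType) (theta' : J -> 'S_4)
    (psi : embedding R D4 (bsize S (l - i.+1 + i).+1)),
    [/\ has_types psi theta',
        forall x, K0 psi x = push (K0_maps S) i (l - i.+1).+1 (K0 phi x) &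
        H1 psi = push (H1_maps S) i (l - i.+1).+1 (H1 phi)].
  exists (I * J)%type, (fun s => (theta s.1 * theta' s.2)%g).
  exists (comp_emb (alpha_comp S i (l - i.+1)) phi); split=> [|x|].
  - exact: has_types_comp.
  - by rewrite (K0_comp _ _ phiT alphaT) ?alpha_comp_K0 //; apply: bsize_gt0.
  by rewrite (H1_comp _ _ phiT alphaT) ?alpha_comp_H1 //; apply: bsize_gt0.
by rewrite -subSn // subSS /trans -addnS subnK.
Qed.

End Limit.

(** * Re-pairing isometries with equal K_0 data *)

(** As types respect sides, a coordinate [j < 2] of the image of [c] counts only values at 0, and
    [j >= 2] only values at 2, so one vector equation yields both counts. *)
Lemma types_K0_eq (R : realType) n n' n1 (alpha : embedding R n n')
    (psi : embedding R n1 n') (I J : finType) (theta : I -> 'S_4) (theta' : J -> 'S_4) :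
    (forall i, 0 < n i)%N -> (forall i, 0 < n1 i)%N ->
    has_types alpha theta -> has_types psi theta' ->
    (let c := delta_mx 0 (inord 0) + delta_mx 0 (inord 2) in
     K0 alpha c = K0 psi c) ->
  forall j, #|[pred s | theta s (inord 0) == j]| = #|[pred s | theta' s (inord 0) == j]|
    /\ #|[pred s | theta s (inord 2) == j]| = #|[pred s | theta' s (inord 2) == j]|.
Proof.
move=> n_gt0 n1_gt0 alphaT psiT /rowP e j; move: (e j).
rewrite /= (K0_mx_types n_gt0 alphaT) (K0_mx_types n1_gt0 psiT) !mulmxDl -!rowE !mxE.
rewrite !summxE.
have E (K : finType) (t : K -> 'S_4) i :
    \sum_s (perm_mx (t s) : 'M[int]_4) i j = #|[pred s | t s i == j]|%:R.
  rewrite -sum1_card natr_sum [RHS]big_mkcond /=; apply: eq_bigr => s _.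
  by rewrite !mxE inE; case: (_ == j).
rewrite !E -!natrD => /eqP; rewrite eqr_nat => /eqP.
have Z (K : finType) (t : K -> 'S_4) (i : 'I_4) : (forall s, respects_sides (t s)) ->
    (i < 2)%N != (j < 2)%N -> #|[pred s | t s i == j]| = 0%N.
  move=> sides ij; apply: eq_card0 => s; rewrite !inE; apply/negP=> /eqP tj.
  by rewrite -(sides s) tj eqxx in ij.
have [V HV _] := alphaT; have [W HW _] := psiT.
have sV := conj_family_sides HV; have sW := conj_family_sides HW.
have [j2|j2] := boolP (j < 2)%N.
  by rewrite !(Z _ _ (inord 2)) ?inordK ?j2 // !addn0.
by rewrite !(Z _ _ (inord 0)) ?inordK ?(negPf j2) // !add0n.
Qed.

Lemma respects_sides_eq (s t : 'S_4) (i j : 'I_4) :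
    respects_sides s -> respects_sides t -> (i < 2)%N = (j < 2)%N ->
  s i = t i -> s j = t j.
Proof.
move=> sS tS ij st; have [<- //|nij] := eqVneq i j; apply: val_inj.
have ne (u : 'S_4) : val (u i) != val (u j).
  by apply/eqP=> /val_inj/perm_inj/eqP; apply/negP.
have := (ne s, ne t); have := (sS i, sS j, tS i, tS j).
have := (ltn_ord (s j), ltn_ord (t j), ltn_ord (t i)).
by rewrite st /= => -[[? ?] ?] [[[? ?] ?] ?] [? ?]; lia.
Qed.

(** An empty sum would be the zero map, which would send the nonzero [min_proj] to 0. *)
Lemma has_types_nonempty (R : realType) n n' (phi : embedding R n n')
    (I : finType) (theta : I -> 'S_4) :
  (forall i, 0 < n i)%N -> has_types phi theta -> (0 < #|I|)%N.
Proof.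
move=> n_gt0 [V _ phiV]; rewrite lt0n; apply/negP=> /eqP/card0_eq I0.
have phi0 a : phi a = 0.
  by apply: val_inj; apply: etrans (phiV a) _; rewrite [LHS]big1 // => s; have := I0 s.
have /(congr1 (fun a => submxblock (cycle4_mx a) 0 0)) : min_proj R n 0 = 0.
  by apply: (@emb_inj _ _ _ phi); rewrite !phi0.
rewrite submxblock_diag eqxx submxblock0 => /(congr1 mxrank).
by rewrite rank_pid_mx // mxrank0.
Qed.

(** Realises the types of [psi] with the isometries of [alpha]. H_1 depends only on the signs of the
    types, so it is that of [psi]; row [i] of [K0_mx] depends only on the multiset of values at [i],
    so it is that of [alpha]. *)
Lemma homology_range_splice (R : realType) n n' n1 (alpha : embedding R n n')
    (psi : embedding R n1 n') (I J : finType) (theta : I -> 'S_4) (theta' : J -> 'S_4) :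
    (forall i, 0 < n i)%N -> (forall i, 0 < n1 i)%N ->
    has_types alpha theta -> has_types psi theta' ->
    (let c := delta_mx 0 (inord 0) + delta_mx 0 (inord 2) in
     K0 alpha c = K0 psi c) ->
  homology_range alpha (H1 psi).
Proof.
move=> n_gt0 n1_gt0 alphaT psiT /(types_K0_eq n_gt0 n1_gt0 alphaT psiT) E.
have [pi pi_bij piE] := fiber_card_bij (fun j => (E j).1).
have [rho rho_bij rhoE] := fiber_card_bij (fun j => (E j).2).
have [V HV alphaV] := alphaT; have [W HW _] := psiT.
have sV := conj_family_sides HV; have sW := conj_family_sides HW.
(* [pi] matches the values at 0 and [rho] those at 2; on a side with two points this settles the
   other point too. *)
have theta'E s (i : 'I_4) : theta' s i = theta ((if i < 2 then pi else rho) s)%N i.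
  case: ifP => i2.
    by apply: (@respects_sides_eq _ _ (inord 0)); rewrite ?inordK ?i2 ?piE.
  by apply: (@respects_sides_eq _ _ (inord 2)); rewrite ?inordK ?i2 ?rhoE.
have HU := conj_family_splice HV (bij_inj pi_bij) (bij_inj rho_bij) sW theta'E.
have J_gt0 : (0 < #|J|)%N.
  by rewrite (bij_eq_card pi_bij) (has_types_nonempty n_gt0 alphaT).
have [beta betaU] := conj_family_embedding HU J_gt0.
have betaT : has_types beta theta' by eexists; [exact: HU | exact: betaU].
exists beta; last first.
  by rewrite (H1_types n_gt0 betaT) (H1_types n1_gt0 psiT).
split; first by exists [seq theta' s | s <- enum J]; exact: has_types_rigid_sum.
move=> x; congr (x *m _).
rewrite (K0_mx_types n_gt0 alphaT) (K0_mx_types n_gt0 betaT).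
apply/matrixP=> i j; rewrite !summxE.
rewrite [RHS](reindex (if (i < 2)%N then pi else rho)) /=; last first.
  by apply: onW_bij; case: ifP.
apply: eq_bigr => s _.
by rewrite !mxE theta'E.
Qed.

(** * The contradiction at a common stage *)

Theorem proposition5p8 (R : realType) (S : generic_system R)
    (hS : hr_asymmetric S) :
  ~ (homology_inversion S @` joint_scale S `<=` joint_scale S).
Proof.
have D4_gt0 (i : 'I_4) : (0 < D4 i)%N by [].
have [phi0 phi0T] := base_embedding R (bsize_gt0 S 0).
have phi0_rigid : rigid phi0.
  by eexists; apply: has_types_rigid_sum phi0T.
have K0phi0 x : K0 phi0 x = x.
  by rewrite /= (K0_mx_types D4_gt0 phi0T) (bigD1 tt) //= big1 ?addr0 => [|[]] //;
     rewrite perm_mx1 mulmx1.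
have H1phi0 : H1 phi0 = 1.
  by rewrite (H1_types D4_gt0 phi0T) (bigD1 tt) //= big1 ?addr0 => [|[]] //; rewrite odd_perm1.
pose c : 'rV[int]_4 := delta_mx 0 (inord 0) + delta_mx 0 (inord 2).
pose x0 := (dlim_in (K0_maps S) 0 c, dlim_in (H1_maps S) 0 1).
have x0_in : joint_scale S x0.
  by exists 0%N, phi0; rewrite K0phi0 H1phi0 K0_class_D4 /H1_map mulr1.
move=> /(_ (homology_inversion S x0)) [|k [psi [[ts tsP]]]]; first by exists x0.
rewrite K0_class_D4 /H1_map mulr1 => -[eK eH].
have {}eH : dlim_in (H1_maps S) 0 (- 1) = dlim_in (H1_maps S) k (H1 psi).
  by rewrite -eH -[RHS]/(dlim_opp _) dlim_oppE.
case/dlim_inP: eK => a /andP[_ ka] eK; case/dlim_inP: eH => b /andP[_ kb] eH.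
(* The equalities in the two limits hold from stages [a] and [b] on; [l] lies beyond both and is
   written as the target index of [alpha_comp S 0 m]. *)
pose m := maxn a b; pose l := (m + 0).+1.
have al : (a <= l)%N by rewrite /l addn0 leqW // leq_maxl.
have bl : (b <= l)%N by rewrite /l addn0 leqW // leq_maxr.
have kl : (k < l)%N by rewrite /l addn0 ltnS leq_max ka.
have psiT := rigid_sum_has_types D4_gt0 tsP.
have [J [theta' [psi' [psi'T K0psi' H1psi']]]] := push_D4 psiT kl.
have [I [theta alphaT]] := alpha_comp_types S 0 m.
have K0_eq : K0 (alpha_comp S 0 m) c = K0 psi' c.
  rewrite K0psi' -(@trans_comp _ _ k a l) ?ka // -eK trans_comp //.
  by rewrite alpha_comp_K0 transE subn0 /l addn0.
have H1_eq : H1 psi' = - H1 (alpha_comp S 0 m).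
  rewrite H1psi' -(@trans_comp _ _ k b l) ?kb // -eH trans_comp //.
  rewrite raddfN; congr (- _).
  by rewrite -[RHS]mulr1 alpha_comp_H1 transE subn0 /l addn0.
have neg_in := homology_range_splice (bsize_gt0 S 0) D4_gt0 alphaT psi'T K0_eq.
rewrite H1_eq in neg_in.
have pos_in : homology_range (alpha_comp S 0 m) (H1 (alpha_comp S 0 m)).
  exists (alpha_comp S 0 m) => //; split=> //.
  by eexists; apply: has_types_rigid_sum alphaT.
(* The homology range contains an integer and its negative; having one sign, it would force this
   integer to be the excluded 0. *)
have [sgn nz] := hS 0%N m; apply: nz.
suff H0 : H1 (alpha_comp S 0 m) = 0 by rewrite H0 in pos_in.
by case: sgn => sgn; have := sgn _ pos_in; have := sgn _ neg_in; rewrite /=; lia.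
Qed.
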